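(* (Geiger–Muller counter of type 1, general arrival flow.) Let $(\tau_k)_{k\ge1}$ and $(\eta_k)_{k\ge1}$ be independent sequences, each consisting of i.i.d. random variables, with $\mathbf{P}(\tau_k<t)=F(t)$, $\mathbf{P}(\eta_k<t)=G(t)$, $F(+0)=0$, $G(+0)=0$. Let $q=\mathbf{P}(\tau_1<\eta_1)=\int_0^\infty F(t)\,dG(t)$, with $0<q<1$. Let $\epsilon_k=I(\tau_k<\eta_k)$, $\nu=\min\{k\ge1:\epsilon_k=1\}$, let $T=\sum_{i=1}^{\nu}\tau_i$ be the time during which the counter does not lose any particle, and let $P_T(t)=\mathbf{P}(T\ge t)$. Then $$P_T(t)=1-F(t)+\int_0^tP_T(t-x)G(x)\,dF(x),$$ and the Laplace transform $\varphi(z)=\mathbf{E}e^{-zT}$ of the distribution of $T$ equals $$\varphi(z)=\frac{\psi(z)-\psi_0(z)}{1-\psi_0(z)},\qquad \psi(z)=\int_0^\infty e^{-zt}\,dF(t),\quad \psi_0(z)=\int_0^\infty e^{-zt}G(t)\,dF(t).$$ Moreover, if $\sigma^2=\mathbf{D}\tau_1<\infty$, then, with $a=\mathbf{E}\tau_1$ and $a_0=\int_0^\infty tG(t)\,dF(t)$, $$\mathbf{E}T=\frac{a}{q},\qquad \mathbf{D}T=\frac{\sigma^2}{q}+\frac{a^2(q-1)+2aa_0}{q^2}.$$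
   Context: Model: a particle reaching the counter when it is free is registered but locks the counter for a random time; particles reaching the counter while it is locked are not registered (are lost). A particle reaches the counter at time $t_0=0$, subsequent particles arrive at times $t_1,t_2,\dots$, and $\tau_k=t_k-t_{k-1}$; $\eta_k$ is the discharge (locking) time of the particle arriving at $t_{k-1}$. $I(A)$ is the indicator of the event $A$, $\mathbf{E}$ denotes expectation and $\mathbf{D}$ variance. Distribution functions are defined by $\mathbf{P}(X<t)$, and $F(+0)$, $G(+0)$ are the right limits at $0$. Here $t\ge0$, $z\ge0$, and $\int_0^t$ denotes integration over $[0,t)$.
   Formalization: The formulas with G are stated assuming P(τ_1=η_1)=0, as they fail when ties have positive probability (τ=1, η uniform on {1,2}); without that assumption they are stated with G(x) replaced by its right limit G(x+0) in the integrals against dF. *)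

(* Defs.v *)
From HB Require Import structures.
From mathcomp Require Import all_boot all_order all_algebra.
From mathcomp Require Import all_classical all_reals all_analysis.

Set Implicit Arguments.
Unset Strict Implicit.
Unset Printing Implicit Defensive.

Import Order.TTheory GRing.Theory Num.Theory.
Import numFieldNormedType.Exports.

Local Open Scope classical_set_scope.
Local Open Scope ring_scope.

Section independence.
Context d (Omega : measurableType d) (R : realType) (P : probability Omega R).

Definition mutually_independent (X : nat -> {RV P >-> R}) : Prop :=
  forall (s : seq nat) (B : nat -> set R), uniq s ->
    (forall k, measurable (B k)) ->
    P (\big[setI/setT]_(k <- s) (X k @^-1` B k)) =
    (\prod_(k <- s) P (X k @^-1` B k))%E.

Definition sigma_of_sequence (X : nat -> {RV P >-> R}) : set (set Omega) :=
  <<s [set A | exists (k : nat) (B : set R),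
         measurable B /\ A = X k @^-1` B] >>.

Definition independent_sequences (X Y : nat -> {RV P >-> R}) : Prop :=
  forall A B : set Omega, sigma_of_sequence X A -> sigma_of_sequence Y B ->
    P (A `&` B) = (P A * P B)%E.

End independence.

(* The measure dF of a distribution function F(t) = P(X < t) is the law of X:
   it is the measure that gives [a, b) the mass F(b) - F(a). *)
Lemma distribution_co d (Omega : measurableType d) (R : realType)
    (P : probability Omega R) (X : {RV P >-> R}) (F : R -> R)
    (hF : forall t, P [set w | X w < t] = (F t)%:E) (a b : R) :
  a <= b -> distribution P X `[a, b[ = (F b - F a)%:E.
Proof.
move=> ab; have mlt t : measurable [set w | X w < t].
  rewrite (_ : [set _ | _] = X @^-1` `]-oo, t[); last first.
    by apply/seteqP; split=> w /=; rewrite in_itv.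
  by rewrite -[X in measurable X]setTI; exact: measurable_funP.
have -> : distribution P X `[a, b[ =
    P ([set w | X w < b] `\` [set w | X w < a]).
  congr (P _); apply/seteqP; split=> w /=; rewrite in_itv /=.
    by move=> /andP[aX Xb]; split=> //; rewrite ltNge aX.
  by move=> [-> /negP]; rewrite -leNgt => ->.
rewrite measureD // ?ltey_eq ?fin_num_measure //.
rewrite setIidr; last by move=> w /= /lt_le_trans; exact.
by rewrite EFinB -!hF.
Qed.

(* Indices are shifted by one: tau k and eta k stand for tau_{k+1} and
   eta_{k+1}. *)
Section counter.
Context d (Omega : measurableType d) (R : realType) (P : probability Omega R).
Variables tau eta : nat -> {RV P >-> R}.

Definition epsilon (k : nat) : Omega -> R := \1_[set w | tau k w < eta k w].

(* nu is the 1-based index of the first loss; on the event that no loss ever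
   occurs, which is null when P(tau_1 < eta_1) > 0, it is set to 0. *)
Definition nu (w : Omega) : nat :=
  if pselect (exists k, epsilon k w == 1) is left h then (ex_minn h).+1 else 0.

Definition lossless_time (w : Omega) : R := \sum_(i < nu w) tau i w.

End counter.

(* Main.v *)
Require Import Defs.
From HB Require Import structures.
From mathcomp Require Import all_boot all_order all_algebra.
From mathcomp Require Import all_classical all_reals all_analysis.
From mathcomp Require Import measurable_realfun.
From mathcomp Require Import ring lra.

Set Implicit Arguments.
Unset Strict Implicit.
Unset Printing Implicit Defensive.

Import Order.TTheory GRing.Theory Num.Theory.
Import numFieldNormedType.Exports.

Local Open Scope classical_set_scope.
Local Open Scope ring_scope.

(** Let [L] be the law of the lossless time [T], and look at the first pair
    (tau, eta). If tau < eta then T = tau; otherwise T = tau + T', where T' is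
    made of the later pairs exactly as T is made of all of them, so that T' has
    law [L] and is independent of (tau, eta). Hence [L] is the image of
    (dF x dG) x [L] under the map [restart]; this is [lossless_law_fix]. With
    k x = P(eta <= x), integrating a function h >= 0 against this identity gives
    [integral_fix],

      int h dL = int ((1 - k x) h x + k x int h (x + s) dL(s)) dF(x),

    and every formula is an instance of it: h is the indicator of [t, oo) for
    the survival function ([survival_fix]), h s = e^(- z s) for the Laplace
    transform ([laplace_fix]), h s = s and h s = s ^ 2 for the moments
    ([fixed_point_moments]). As int k dF = 1 - q with q > 0, the resulting affine
    equations, such as E T = a + (1 - q) E T, have one finite solution; that the
    moments are finite is obtained from the inequalities which the identity
    gives for the truncations min (s, n), followed by monotone convergence.

    For the fixed point property, independence is only used on finite-dimensional
    rectangle events. A quantity defined by backward recursion over n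
    pairs, starting from a constant, is independent of any earlier rectangle
    event and its law does not depend on where the n pairs start
    ([unrolled_independent]); so its law at n + 1 is determined by its law at n
    ([unrolled_law]). The recursion by [restart] coincides with T unless no loss
    occurs among the first n pairs, which has probability (1 - q) ^ n, and the
    identity passes to the limit in total variation.

    Finally k is the right limit of G ([df_right_limit]), and it equals G at
    dF-almost every point when ties tau = eta are negligible ([keep_no_tie]):
    this is how the kernel K of the statement is related to k. *)

(** * Measures determined by rectangles and half-lines *)

Section measure_extensionality.
Local Open Scope ereal_scope.

Lemma prod_measure_ext d1 d2 (T1 : measurableType d1) (T2 : measurableType d2)
    (R : realType) (mu1 mu2 : {measure set (T1 * T2) -> \bar R}) :
  mu1 setT < +oo ->
  (forall A B, measurable A -> measurable B -> mu1 (A `*` B) = mu2 (A `*` B)) ->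
  forall X, measurable X -> mu1 X = mu2 X.
Proof.
move=> mu1oo mu12 X mX.
apply: (measure_unique [set A `*` B | A in measurable & B in measurable]
  (fun=> setT)) => //.
- exact: measurable_prod_measurableType.
- move=> _ _ [A mA [B mB <-]] [C mC [D mD <-]].
  exists (A `&` C); first exact: measurableI.
  by exists (B `&` D); [exact: measurableI|rewrite setXI].
- by move=> _; exists setT => //; exists setT => //; rewrite setXTT.
- by rewrite bigcup_const.
- by move=> _ [A mA [B mB <-]]; exact: mu12.
Qed.

(** [pushforward] is a measure only in the presence of a measurability proof;
    carrying that proof as an argument lets the measure structure be used for
    maps that are not declared measurable functions. *)
Definition image_measure d d' (T1 : measurableType d) (T2 : measurableType d')
    (R : realType) (m : {measure set T1 -> \bar R}) (f : T1 -> T2)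
    (mf : measurable_fun setT f) : {measure set T2 -> \bar R}.
Proof.
by unshelve refine (pushforward m f : {measure set T2 -> \bar R}).
Defined.

(** For a fixed third side [C], both sides are measures in the first two
    variables, so the two-factor case applies twice. *)
Lemma prod3_measure_ext d1 d2 d3 (T1 : measurableType d1)
    (T2 : measurableType d2) (T3 : measurableType d3)
    (R : realType) (mu1 mu2 : {measure set (T1 * T2 * T3) -> \bar R}) :
  mu1 setT < +oo ->
  (forall A B C, measurable A -> measurable B -> measurable C ->
    mu1 ((A `*` B) `*` C) = mu2 ((A `*` B) `*` C)) ->
  forall X, measurable X -> mu1 X = mu2 X.
Proof.
move=> mu1oo mu12 X mX; apply: prod_measure_ext => // Q C mQ mC.
pose slab : set (T1 * T2 * T3) := setT `*` C.
have mslab : measurable slab by exact: measurableX.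
pose nu (mu : {measure set (T1 * T2 * T3) -> \bar R}) :=
  image_measure (mrestr mu mslab : {measure set _ -> \bar R})
    (measurable_fst : measurable_fun setT (@fst (T1 * T2) T3)).
have nuE (mu : {measure set (T1 * T2 * T3) -> \bar R}) (Z : set (T1 * T2)) :
    nu mu Z = mu (Z `*` C).
  rewrite /nu /image_measure /= /pushforward /mrestr; congr (mu _).
  by apply/seteqP; split=> -[p s] /=; rewrite /slab /=; [case=> ? [_ ?]|case].
rewrite -!nuE; apply: (@prod_measure_ext _ _ _ _ _ (nu mu1) (nu mu2)) => //.
- by rewrite nuE; apply: le_lt_trans mu1oo; apply: le_measure; rewrite ?inE//; exact: mslab.
- by move=> A B mA mB; rewrite !nuE; exact: mu12.
Qed.

Lemma law_ext d (Omega : measurableType d) (R : realType)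
    (P : probability Omega R) (X Y : {RV P >-> R}) :
  (forall t, P [set w | (X w < t)%R] = P [set w | (Y w < t)%R]) ->
  forall A, measurable A -> P (X @^-1` A) = P (Y @^-1` A).
Proof.
move=> XY; have rayE (Z : {RV P >-> R}) t :
    Z @^-1` `]-oo, t[ = [set w | (Z w < t)%R].
  by apply/seteqP; split=> w /=; rewrite in_itv.
move=> A mA; pose muX : {measure set R -> \bar R} := distribution P X.
pose muY : {measure set R -> \bar R} := distribution P Y.
apply: (@measure_unique _ R R (@RGenInftyO.G R)
  (fun n => `]-oo, (n%:R : R)[%classic) _ _ _ _ muX muY) => //.
- exact: RGenInftyO.measurableE.
- move=> _ _ [x ->] [y ->]; exists (Num.min x y).
  by apply/seteqP; split=> z /=; rewrite !in_itv/= lt_min => /andP.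
- by move=> n; exists n%:R.
- rewrite -subTset => x _; exists (Num.truncn x).+1 => //=.
  by rewrite in_itv/= truncnS_gt.
- by move=> _ [t ->]; have := XY t; rewrite -!rayE.
- by move=> n; rewrite ltey_eq fin_num_measure.
Qed.

End measure_extensionality.

(** * Backward recursion over independent pairs *)

Section backward_recursion.
Local Open Scope ereal_scope.
Context d (Omega : measurableType d) (R : realType) (P : probability Omega R).
Variables tau eta : nat -> {RV P >-> R}.
Hypothesis tau_indep : mutually_independent tau.
Hypothesis eta_indep : mutually_independent eta.
Hypothesis tau_eta_indep : independent_sequences tau eta.
Hypothesis tau_id : forall k A, measurable A ->
  P (tau k @^-1` A) = P (tau 0%N @^-1` A).
Hypothesis eta_id : forall k A, measurable A ->
  P (eta k @^-1` A) = P (eta 0%N @^-1` A).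

Local Notation dF := (distribution P (tau 0%N)).
Local Notation dG := (distribution P (eta 0%N)).

(** An event about the first [m] pairs which is a rectangle; conditioning on
    such events is all that the independence of past and future requires. *)
Definition history (B C : nat -> set R) (m : nat) : set Omega :=
  (\big[setI/setT]_(k <- iota 0 m) (tau k @^-1` B k)) `&`
  (\big[setI/setT]_(k <- iota 0 m) (eta k @^-1` C k)).

Lemma history0 (B C : nat -> set R) : history B C 0 = setT.
Proof. by rewrite /history !big_nil setIT. Qed.

Lemma measurable_history (B C : nat -> set R) m :
  (forall k, measurable (B k)) -> (forall k, measurable (C k)) ->
  measurable (history B C m).
Proof.
by move=> mB mC; apply: measurableI; apply: bigsetI_measurable => k _;
  exact: measurable_funPTI.
Qed.

Lemma history_proba (B C : nat -> set R) m :
  (forall k, measurable (B k)) -> (forall k, measurable (C k)) ->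
  P (history B C m) = \prod_(k <- iota 0 m) dF (B k) *
                      \prod_(k <- iota 0 m) dG (C k).
Proof.
move=> mB mC; rewrite /history tau_eta_indep.
- rewrite tau_indep ?iota_uniq// eta_indep ?iota_uniq//.
  by congr (_ * _); apply: eq_bigr => k _; [exact: tau_id|exact: eta_id].
- apply: (@bigsetI_measurable _ (g_sigma_algebraType
    [set A | exists k B, measurable B /\ A = tau k @^-1` B])) => k _.
  by apply: sub_sigma_algebra; exists k, (B k).
- apply: (@bigsetI_measurable _ (g_sigma_algebraType
    [set A | exists k B, measurable B /\ A = eta k @^-1` B])) => k _.
  by apply: sub_sigma_algebra; exists k, (C k).
Qed.

(** Adding a constraint on the pair of index [m] to a history of length [m] is a
    history of length [m + 1], so no event more general than a history arises
    in the induction of [unrolled_independent]. *)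
Lemma history_extend (B C : nat -> set R) m (A1 A2 : set R) :
  (forall k, measurable (B k)) -> (forall k, measurable (C k)) ->
  measurable A1 -> measurable A2 ->
  exists B' C', [/\ forall k, measurable (B' k), forall k, measurable (C' k),
    history B' C' m.+1 =
      history B C m `&` (tau m @^-1` A1 `&` eta m @^-1` A2) &
    P (history B' C' m.+1) = P (history B C m) * (dF A1 * dG A2)].
Proof.
move=> mB mC mA1 mA2.
pose upd (D : nat -> set R) A k := if k == m then A else D k.
have updE D A k : k \in iota 0 m -> upd D A k = D k.
  by rewrite mem_iota add0n /upd; case: eqP => // -> /andP[_]; rewrite ltnn.
have updm D A : upd D A m = A by rewrite /upd eqxx.
have mupd D A : (forall k, measurable (D k)) -> measurable A ->
    forall k, measurable (upd D A k).
  by move=> mD mA k; rewrite /upd; case: ifP.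
exists (upd B A1), (upd C A2); split; [exact: mupd|exact: mupd| |].
- rewrite /history -addn1 iotaD add0n !big_cat !big_seq1/= !updm setIACA.
  by congr ((_ `&` _) `&` _); rewrite big_seq [RHS]big_seq;
    apply: eq_bigr => k /updE ->.
- rewrite !history_proba//; [|exact: mupd|exact: mupd].
  rewrite -addn1 iotaD add0n !big_cat !big_seq1/= !updm muleACA.
  by congr ((_ * _) * _); rewrite big_seq [RHS]big_seq;
    apply: eq_bigr => k /updE ->.
Qed.

Variables (r : R * R * R -> R) (v0 : R).
Hypothesis mr : measurable_fun setT r.

(** The value at index [m] of the recursion V_i = r (tau_i, eta_i, V_(i+1))
    stopped at V_(m+n) = [v0]: it only involves the pairs of indices
    m, ..., m + n - 1. *)
Fixpoint unrolled (n m : nat) : Omega -> R :=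
  if n is n'.+1 then fun w => r (tau m w, eta m w, unrolled n' m.+1 w)
  else cst v0.

Lemma measurable_unrolled n m : measurable_fun setT (unrolled n m).
Proof.
elim: n m => [|n IH] m /=; first exact: measurable_cst.
by apply: measurableT_comp => //; do 2 ?apply: measurable_fun_pair => //.
Qed.

HB.instance Definition _ n m :=
  isMeasurableFun.Build _ _ _ _ (unrolled n m) (measurable_unrolled n m).

(** If the recursion over [n] pairs is independent of the past, then the pair of
    index [m] and the recursion over the [n] pairs after it have a product law,
    even on a history: on a measurable box both sides reduce to the
    independence hypothesis for a history of length [m + 1], and boxes determine
    finite measures. *)
Lemma unrolled_joint_law n :
  (forall m B C A, (forall k, measurable (B k)) -> (forall k, measurable (C k)) ->
    measurable A ->
    P (history B C m `&` unrolled n m @^-1` A) =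
    P (history B C m) * P (unrolled n 0 @^-1` A)) ->
  forall m B C X, (forall k, measurable (B k)) -> (forall k, measurable (C k)) ->
    measurable X ->
    P (history B C m `&`
       (fun w => (tau m w, eta m w, unrolled n m.+1 w)) @^-1` X) =
    P (history B C m) * ((dF \x dG) \x distribution P (unrolled n 0)) X.
Proof.
move=> IH m B C X mB mC mX.
have mH := measurable_history m mB mC.
pose Z w := (tau m w, eta m w, unrolled n m.+1 w).
have mZ : measurable_fun setT Z.
  do 2 ?apply: measurable_fun_pair => //; exact: measurable_unrolled.
pose c : {nonneg R} := NngNum (fine_ge0 (measure_ge0 P (history B C m))).
have cE : c%:num%:E = P (history B C m) by rewrite /= fineK// fin_num_measure.
pose mu1 := image_measure (mrestr P mH : {measure set _ -> \bar R}) mZ.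
pose mu2 : {measure set (R * R * R) -> \bar R} :=
  mscale c ((dF \x dG) \x distribution P (unrolled n 0)).
have -> : P (history B C m `&` Z @^-1` X) = mu1 X.
  by rewrite /mu1 /= /pushforward /mrestr setIC.
rewrite -cE; apply: (@prod3_measure_ext _ _ _ _ _ _ _ mu1 mu2) => //.
- by rewrite /mu1 /= /pushforward /mrestr ltey_eq fin_num_measure//
    preimage_setT setTI.
- move=> A1 A2 A3 mA1 mA2 mA3.
  have [B' [C' [mB' mC' HE PE]]] := history_extend m mB mC mA1 mA2.
  rewrite /mu1 /mu2 /= /pushforward /mrestr /mscale cE.
  transitivity (P (history B C m) *
      (dF A1 * dG A2 * distribution P (unrolled n 0) A3)); last first.
    congr (_ * _); rewrite -(product_measure1E _ _ mA1 mA2); apply/esym.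
    exact: (product_measure1E (dF \x dG) _ (measurableX mA1 mA2) mA3).
  rewrite muleA -PE -IH// HE; congr (P _).
  by apply/seteqP; split=> w /=; tauto.
Qed.

(** Both independence from the past and stationarity, by induction on [n]: the
    joint law of [unrolled_joint_law] is computed once on the given history and
    once on the trivial history at index 0, with the same product measure. *)
Lemma unrolled_independent n m (B C : nat -> set R) A :
  (forall k, measurable (B k)) -> (forall k, measurable (C k)) ->
  measurable A ->
  P (history B C m `&` unrolled n m @^-1` A) =
  P (history B C m) * P (unrolled n 0 @^-1` A).
Proof.
elim: n m B C A => [|n IH] m B C A mB mC mA.
  rewrite /= !preimage_cst; case: ifPn => _.
    by rewrite setIT probability_setT mule1.
  by rewrite setI0 measure0 mule0.
have mrA : measurable (r @^-1` A) by rewrite -[X in measurable X]setTI; exact: mr.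
have /= -> := unrolled_joint_law IH m mB mC mrA.
have /= := unrolled_joint_law IH 0%N mB mC mrA.
rewrite !history0 !setTI probability_setT mul1e => <-.
by [].
Qed.

Lemma head_law X : measurable X ->
  P ((fun w => (tau 0%N w, eta 0%N w)) @^-1` X) = (dF \x dG) X.
Proof.
move=> mX; have := unrolled_joint_law (@unrolled_independent 0%N) 0%N
  (fun=> measurableT) (fun=> measurableT) (measurableX mX measurableT).
rewrite !history0 !setTI probability_setT mul1e => E.
have -> : (fun w => (tau 0%N w, eta 0%N w)) @^-1` X =
    (fun w => (tau 0%N w, eta 0%N w, unrolled 0 1 w)) @^-1` (X `*` setT).
  by apply/seteqP; split=> w /=; tauto.
apply: etrans E _.
apply: etrans (product_measure1E (dF \x dG) _ mX measurableT) _.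
by rewrite -[RHS]mule1; congr (_ * _); exact: probability_setT.
Qed.

Lemma unrolled_law n A : measurable A ->
  distribution P (unrolled n.+1 0) A =
  ((dF \x dG) \x distribution P (unrolled n 0)) (r @^-1` A).
Proof.
move=> mA.
have mrA : measurable (r @^-1` A) by rewrite -[X in measurable X]setTI; exact: mr.
have := unrolled_joint_law (@unrolled_independent n) 0%N
  (fun=> measurableT) (fun=> measurableT) mrA.
by rewrite !history0 !setTI probability_setT mul1e => <-.
Qed.

End backward_recursion.

(** * The restart map and the loss events *)

Section restart.
Context (R : realType).

(** A point of R * R * R is an interarrival time x, a discharge time y, and the
    time s that the counter, if it restarts afresh after x, takes to lose a
    particle. *)
Definition restart (z : R * R * R) : R :=
  if z.1.2 <= z.1.1 then z.1.1 + z.2 else z.1.1.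

Lemma measurable_restart : measurable_fun setT restart.
Proof.
apply: measurable_fun_ifT.
- by apply: measurable_fun_ler; apply: measurableT_comp.
- by apply: measurable_funD => //; apply: measurableT_comp.
- by apply: measurableT_comp.
Qed.

End restart.

Section loss_events.
Context (R : realType).

Lemma measurable_no_loss : measurable [set p : R * R | p.2 <= p.1].
Proof.
have m : measurable_fun setT (fun p : R * R => p.2 <= p.1).
  exact: measurable_fun_ler.
by have := m measurableT [set true] I; rewrite setTI.
Qed.

Lemma measurable_loss : measurable [set p : R * R | p.1 < p.2].
Proof.
have m : measurable_fun setT (fun p : R * R => p.1 < p.2).
  exact: measurable_fun_ltr.
by have := m measurableT [set true] I; rewrite setTI.
Qed.

Lemma measurable_tie : measurable [set p : R * R | p.1 = p.2].
Proof.
have m : measurable_fun setT (fun p : R * R => p.1 == p.2).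
  exact: measurable_fun_eqr.
have := m measurableT [set true] I; rewrite setTI.
rewrite (_ : _ @^-1` _ = [set p : R * R | p.1 = p.2])//.
by apply/seteqP; split=> p /= /eqP.
Qed.

Lemma no_loss_proba (J : probability (R * R)%type R) (q : R) :
  J [set p | p.1 < p.2] = q%:E -> J [set p | p.2 <= p.1] = (1 - q)%:E.
Proof.
move=> q_def; rewrite EFinB -q_def -(probability_setC J measurable_loss).
by congr (J _); apply/seteqP; split=> p /=; rewrite leNgt => /negP.
Qed.

End loss_events.

(** * Integration against the fixed point law *)

Section fixed_point.
Context (R : realType) (dF dG L : probability R R).
Local Open Scope ereal_scope.
Hypothesis L_fix : forall A, measurable A ->
  L A = ((dF \x dG) \x L) (@restart R @^-1` A).

(** The probability that a particle arriving after time [x] is not lost, that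
    is, P(eta <= x). *)
Definition keep (x : R) : R := fine (dG `]-oo, x]%classic).

Lemma keepE x : (keep x)%:E = dG `]-oo, x]%classic.
Proof. by rewrite /keep fineK// fin_num_measure. Qed.

Lemma keep_ge0 x : (0 <= keep x)%R.
Proof. by rewrite -lee_fin keepE. Qed.

Lemma keep_le1 x : (keep x <= 1)%R.
Proof. by rewrite -lee_fin keepE probability_le1. Qed.

Lemma measurable_keep D : measurable D -> measurable_fun D keep.
Proof.
move=> mD; apply: nondecreasing_measurable => // x y xy.
by rewrite -lee_fin !keepE le_measure ?inE//; exact: subset_itvl.
Qed.

Lemma lossE x : (1 - keep x)%:E = dG `]x, +oo[%classic.
Proof.
rewrite EFinB keepE -(setCitvl) probability_setC//.
Qed.

(** Tonelli for the triple product: given x, the variable y only decides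
    between x and x + s, with weights [1 - keep x] and [keep x]. *)
Lemma integral_fix (h : R -> \bar R) : measurable_fun setT h ->
  (forall x, 0 <= h x) ->
  \int[L]_s h s = \int[dF]_x ((1 - keep x)%:E * h x +
                              (keep x)%:E * \int[L]_s h (x + s)%R).
Proof.
move=> mh h0.
pose J : probability (R * R)%type R := dF \x dG.
pose M : {measure set (R * R * R) -> \bar R} := (dF \x dG) \x L.
have mhr : measurable_fun setT (h \o @restart R).
  by apply: measurableT_comp => //; exact: measurable_restart.
transitivity (\int[M]_z h (restart z)).
  apply: etrans (_ : \int[image_measure M (@measurable_restart R)]_s h s = _).
    by apply: eq_measure_integral => A mA _; exact: L_fix.
  by rewrite (ge0_integral_pushforward (@measurable_restart R)).
have hr0 z : 0 <= (h \o @restart R) z by exact: h0.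
transitivity (\int[dF \x dG]_p fubini_F L (h \o @restart R) p).
  exact: (fubini_tonelli1 (m1 := J) (m2 := L) _ mhr hr0).
have mF : measurable_fun setT (fubini_F L (h \o @restart R)).
  exact: (measurable_fun_fubini_tonelli_F (m2 := L)).
have F0 p : 0 <= fubini_F L (h \o @restart R) p.
  by apply: integral_ge0 => s _; exact: hr0.
rewrite (fubini_tonelli1 (m1 := dF) (m2 := dG) _ mF F0).
apply: eq_integral => x _; rewrite /fubini_F /restart/=.
transitivity (\int[dG]_y ((\1_(`]-oo, x]%classic) y)%:E * (\int[L]_s h (x + s)%R) +
    (\1_(`]x, +oo[%classic) y)%:E * h x)).
  apply: eq_integral => y _; rewrite !indicE !mem_setE !in_itv/= andbT.
  have [yx|xy] := leP y x; first by rewrite mul1e mul0e adde0.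
  rewrite mul0e add0e mul1e integral_cst//.
  by rewrite [X in _ * X](_ : _ = 1) ?mule1//; exact: probability_setT.
have H0 : 0 <= \int[L]_s h (x + s)%R by exact: integral_ge0.
rewrite ge0_integralD//=; last 4 first.
- by move=> y _; rewrite mule_ge0// lee_fin.
- by apply: emeasurable_funM => //; apply/measurable_EFinP.
- by move=> y _; rewrite mule_ge0// lee_fin.
- by apply: emeasurable_funM => //; apply/measurable_EFinP.
rewrite !ge0_integralZr//=; try by apply/measurable_EFinP.
by rewrite !integral_indic// !setIT addeC lossE keepE.
Qed.

End fixed_point.

(** * Integration on the half-line for laws of nonnegative variables *)

Section half_line.
Context (R : realType).
Implicit Type mu : probability R R.

Local Notation D := (`[0%R, +oo[%classic : set R).

Lemma rayD (x y : R) : D x -> D y -> D (x + y).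
Proof. by rewrite /= !in_itv/= !andbT; exact: addr_ge0. Qed.

Lemma ray_ge0 (x : R) : D x -> 0 <= x.
Proof. by rewrite /= in_itv/= andbT. Qed.

Lemma proba_ray mu : mu `]-oo, 0[%classic = 0%E -> mu D = 1%E.
Proof.
move=> mu0; have := probability_setC mu (measurable_itv `]-oo, (0 : R)[).
by rewrite mu0 sube0 setCitvl.
Qed.

Lemma integral_ray mu (f : R -> \bar R) : mu `]-oo, 0[%classic = 0%E ->
  measurable_fun setT f -> (forall x, 0 <= f x)%E ->
  (\int[mu]_x f x = \int[mu]_(x in D) f x)%E.
Proof.
move=> mu0 mf f0; rewrite (ge0_negligible_integral (N := (`]-oo, (0 : R)[%classic : set R)))//.
by congr integral; rewrite setTD setCitvl.
Qed.

Lemma ray_integrable mu (f : R -> R) C : measurable_fun D f ->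
  (forall x, D x -> `|f x| <= C) -> mu.-integrable D (EFin \o f).
Proof.
move=> mf fC; apply: (@le_integrable _ _ _ _ _ _ _ (EFin \o cst C)) => //.
- exact/measurable_EFinP.
- by move=> x Dx /=; rewrite lee_fin (le_trans (fC _ Dx))// ler_norm.
- exact: finite_measure_integrable_cst.
Qed.

Lemma ray_integrableD mu (f g : R -> R) :
  mu.-integrable D (EFin \o f) -> mu.-integrable D (EFin \o g) ->
  mu.-integrable D (EFin \o (fun x => f x + g x)).
Proof.
by move=> fi gi; apply: eq_integrable (integrableD _ fi gi).
Qed.

Lemma ray_integrableZl mu c (f : R -> R) :
  mu.-integrable D (EFin \o f) ->
  mu.-integrable D (EFin \o (fun x => c * f x)).
Proof.
by move=> fi; apply: eq_integrable (integrableZl _ c fi).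
Qed.

Lemma ray_RintegralD mu (f g : R -> R) :
  mu.-integrable D (EFin \o f) -> mu.-integrable D (EFin \o g) ->
  \int[mu]_(x in D) (f x + g x) =
  \int[mu]_(x in D) f x + \int[mu]_(x in D) g x.
Proof. by move=> fi gi; exact: RintegralD. Qed.

Lemma ray_RintegralZl mu c (f : R -> R) :
  mu.-integrable D (EFin \o f) ->
  \int[mu]_(x in D) (c * f x) = c * \int[mu]_(x in D) f x.
Proof. by move=> fi; exact: RintegralZl. Qed.

Lemma EFin_Rintegral mu (f : R -> R) : mu.-integrable D (EFin \o f) ->
  (\int[mu]_(x in D) (f x)%:E)%E = (\int[mu]_(x in D) f x)%:E.
Proof. by move=> mf; rewrite /Rintegral fineK//; exact: integrable_fin_num. Qed.

Lemma ray_Rintegral_cst mu (c : R) : mu `]-oo, 0[%classic = 0%E ->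
  \int[mu]_(x in D) c = c.
Proof.
move=> mu0; rewrite Rintegral_cst// [X in _ * fine X](_ : _ = 1%E) ?mulr1//.
exact: proba_ray.
Qed.

(** The monotone convergence theorem in the form of a finiteness criterion. *)
Lemma ray_integrable_limit mu (g : nat -> R -> R) (f : R -> R) B :
  (forall n, measurable_fun D (g n)) -> measurable_fun D f ->
  (forall n x, D x -> 0 <= g n x) ->
  (forall x, D x -> {homo g ^~ x : m n / (m <= n)%N >-> m <= n}) ->
  (forall x, D x -> g n x @[n --> \oo] --> f x) ->
  (forall n, mu.-integrable D (EFin \o g n)) ->
  (forall n, \int[mu]_(x in D) g n x <= B) ->
  mu.-integrable D (EFin \o f).
Proof.
move=> mg mf g0 ndg gf ig gB.
have f0 x : D x -> 0 <= f x.
  by move=> Dx; apply: (cvgr_to_ge (gf x Dx)); apply: nearW => n; exact: g0.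
apply/integrableP; split; first exact/measurable_EFinP.
have -> : (\int[mu]_(x in D) `|(EFin \o f) x| =
    \int[mu]_(x in D) limn (fun n => (g n x)%:E))%E.
  apply: eq_integral => x /[!inE] Dx /=; rewrite ger0_norm ?f0//.
  apply/esym/cvg_lim => //; apply: cvg_EFin; first exact: nearW.
  exact: gf.
rewrite monotone_convergence//.
- apply: le_lt_trans (ltry B); apply: lime_le.
    apply: ereal_nondecreasing_is_cvgn => m n mn; apply: ge0_le_integral => //.
    + by move=> x Dx; rewrite lee_fin g0.
    + exact/measurable_EFinP.
    + exact/measurable_EFinP.
    + by move=> x Dx; rewrite lee_fin ndg.
  by apply: nearW => n; rewrite EFin_Rintegral// lee_fin.
- by move=> n; exact/measurable_EFinP.
Qed.

End half_line.

(** * The renewal identity for real-valued functions *)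

Section renewal.
Context (R : realType) (dF dG L : probability R R).
Hypothesis L_fix : forall A, measurable A ->
  (L A = ((dF \x dG) \x L) (@restart R @^-1` A))%E.
Hypothesis dF_neg : dF `]-oo, 0[%classic = 0%E.
Hypothesis L_neg : L `]-oo, 0[%classic = 0%E.
Local Notation k := (keep dG).
Local Notation D := (`[0%R, +oo[%classic : set R).

(** The inner integrand of [integral_fix], as a function of type [R -> R] so that
    its integrals can be rewritten by equalities of functions. *)
Definition translate (h : R -> R) (x : R) : R -> R := fun s => h (x + s).

Definition mix (u v : R -> R) : R -> R :=
  fun x => (1 - k x) * u x + k x * v x.

(** [integral_fix] with real integrals over the half-line, which carries both
    laws and is closed under addition. The measurability of [H] comes from
    Tonelli. *)
Lemma Rintegral_fix (h H : R -> R) : measurable_fun D h ->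
  (forall x, D x -> 0 <= h x) ->
  (forall x, D x -> L.-integrable D (EFin \o translate h x)) ->
  (forall x, D x -> \int[L]_(s in D) translate h x s = H x) ->
  measurable_fun D H /\
  \int[L]_(s in D) h s = \int[dF]_(x in D) mix h H x.
Proof.
move=> mh h0 ih HE.
pose h' := (EFin \o h) \_ D.
have mh' : measurable_fun setT h'.
  by apply/(measurable_restrictT _ _).1 => //; exact/measurable_EFinP.
have h'0 x : (0 <= h' x)%E.
  by rewrite /h' patchE; case: ifPn => //= /[!inE] Dx; rewrite lee_fin h0.
have h'E x : D x -> h' x = (h x)%:E by move=> Dx; rewrite /h' patchE mem_set.
have innerE x : D x ->
    (\int[L]_s h' (x + s)%R = (H x)%:E)%E.
  move=> Dx; rewrite integral_ray//; last first.
    by apply: measurableT_comp => //; exact: measurable_funD.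
  rewrite -HE// -EFin_Rintegral//; last exact: ih.
  by apply: eq_integral => s /[!inE] Ds; rewrite h'E//; exact: rayD.
have mH : measurable_fun setT (fun x : R => \int[L]_s h' (x + s)%R)%E.
  apply: (measurable_fun_fubini_tonelli_F (m2 := L)
    (fun z : R * R => h' (z.1 + z.2))) => //.
  apply: measurableT_comp => //.
  by apply: measurable_funD; [exact: measurable_fst|exact: measurable_snd].
have H0 (x : R) : (0 <= \int[L]_s h' (x + s)%R)%E by exact: integral_ge0.
split.
  apply/measurable_EFinP.
  apply: (@eq_measurable_fun _ _ _ _ _ (fun x : R => \int[L]_s h' (x + s)%R)%E).
    by move=> x /[!inE] Dx; rewrite innerE.
  exact: measurable_funTS.
rewrite /Rintegral; congr fine.
transitivity (\int[L]_s h' s)%E.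
  by rewrite integral_ray//; apply: eq_integral => s /[!inE] /h'E ->.
rewrite (integral_fix L_fix)// integral_ray//.
- by apply: eq_integral => x /[!inE] Dx; rewrite h'E// innerE.
- apply: emeasurable_funD; apply: emeasurable_funM => //; apply/measurable_EFinP.
    by apply: measurable_funB => //; exact: measurable_keep.
  exact: measurable_keep.
- move=> x; rewrite adde_ge0// mule_ge0// lee_fin ?keep_ge0//.
  by rewrite subr_ge0 keep_le1.
Qed.

End renewal.

(** * Survival function and Laplace transform *)

Section renewal_consequences.
Context (R : realType) (dF dG L : probability R R) (q : R).
Hypothesis L_fix : forall A, measurable A ->
  (L A = ((dF \x dG) \x L) (@restart R @^-1` A))%E.
Hypothesis dF_neg : dF `]-oo, 0[%classic = 0%E.
Hypothesis L_neg : L `]-oo, 0[%classic = 0%E.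
Hypothesis q_def : ((dF \x dG) [set p | (p.1 < p.2)%R] = q%:E)%E.
Hypothesis q_gt0 : 0 < q.
Local Notation k := (keep dG).
Local Notation D := (`[0%R, +oo[%classic : set R).

(** The total mass of the kernel, P(eta <= tau), is the contraction factor of all
    the equations below. *)
Lemma Rintegral_keep : \int[dF]_(x in D) k x = 1 - q.
Proof.
rewrite /Rintegral -(integral_ray dF_neg); last 2 first.
- by apply/measurable_EFinP; exact: measurable_keep.
- by move=> x; rewrite lee_fin keep_ge0.
transitivity (fine ((dF \x dG) [set p : R * R | (p.2 <= p.1)%R])%E).
  congr fine; apply: eq_integral => x _; rewrite keepE /=; congr (dG _).
  by apply/seteqP; split=> y; rewrite /xsection /= in_itv/= inE.
by have := @no_loss_proba R (dF \x dG)%E q q_def => /= ->.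
Qed.

Lemma keep_integrable (f : R -> R) : dF.-integrable D (EFin \o f) ->
  dF.-integrable D (EFin \o (fun x => f x * k x)).
Proof.
move=> fi; have mf := measurable_int _ fi; apply: le_integrable fi => //.
- apply/measurable_EFinP; apply: measurable_funM; last exact: measurable_keep.
  exact/measurable_EFinP.
- move=> x _ /=; rewrite lee_fin normrM ler_piMr//.
  by rewrite ger0_norm ?keep_ge0// keep_le1.
Qed.

Lemma ray_indic_Rintegral (mu : probability R R) (A : set R) : measurable A ->
  \int[mu]_(x in D) (\1_A x) = fine (mu (A `&` D)).
Proof. by move=> mA; rewrite /Rintegral integral_indic. Qed.

(** [Rintegral_fix] for the indicator of [t, oo): if [t <= x], restarting is of
    no consequence because T >= x holds anyway; otherwise the remaining time
    must be at least t - x. *)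
Lemma survival_fix (t : R) : 0 <= t ->
  fine (L `[t, +oo[%classic) = fine (dF `[t, +oo[%classic) +
    \int[dF]_(x in `[0, t[) (fine (L `[(t - x), +oo[%classic) * k x).
Proof.
move=> t0; set P := fun s => fine (L `[s, +oo[%classic).
have P01 s : 0 <= P s <= 1.
  by rewrite /P fine_ge0//= -lee_fin fineK ?fin_num_measure// probability_le1.
have mP (s : R) : measurable_fun setT (fun x : R => P (s - x)).
  apply: nondecreasing_measurable => // x y xy.
  rewrite /P fine_le ?fin_num_measure// le_measure ?inE//.
  by move=> z /=; rewrite !in_itv/= !andbT; apply: le_trans; lra.
have shift x : translate \1_`[t, +oo[%classic x = \1_`[t - x, +oo[%classic.
  apply/funext => s; rewrite /translate !indicE !mem_setE !in_itv/= !andbT.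
  by congr (nat_of_bool _)%:R; rewrite lerBlDl.
have bnd (A : set R) (x : R) : `|\1_A x : R| <= 1.
  by rewrite indicE; case: (_ \in _); rewrite ?normr1 ?normr0.
have sub (s : R) : 0 <= s -> `[s, +oo[ `&` D = `[s, +oo[%classic.
  move=> s0; apply/seteqP; split=> x /=; rewrite !in_itv/= !andbT; first by case.
  by move=> sx; split => //; exact: le_trans sx.
have tailE (mu : probability R R) (s : R) : 0 <= s ->
    \int[mu]_(x in D) (\1_`[s, +oo[%classic x) = fine (mu `[s, +oo[%classic).
  by move=> s0; rewrite ray_indic_Rintegral// sub.
rewrite -(tailE L t t0); pose H x := if t <= x then 1 else P (t - x).
have [||x Dx|x Dx|mH ->] := @Rintegral_fix R dF dG L L_fix dF_neg L_neg
    (\1_`[t, +oo[%classic : R -> R) H.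
- exact: measurable_indic.
- by move=> x _; rewrite indicE.
- rewrite shift; exact: (@ray_integrable _ L _ 1).
- rewrite shift ray_indic_Rintegral// /H; have [tx|xt] := leP t x.
    have -> : `[t - x, +oo[ `&` D = D.
      apply/setIidPr => s /=; rewrite !in_itv/= !andbT; apply: le_trans.
      by rewrite subr_le0.
    by rewrite proba_ray.
  by rewrite sub ?subr_ge0 1?ltW.
rewrite -(tailE dF t t0).
have it : dF.-integrable D (EFin \o \1_`[t, +oo[%classic).
  exact: (@ray_integrable _ _ _ 1).
have Dt : `[0, t[%classic = D `&` `[0, t[%classic.
  by apply/esym/setIidPr; exact: subset_itvl.
rewrite Dt Rintegral_mkcondr -RintegralD//; last first.
  apply: (@ray_integrable _ _ _ 1) => [|x Dx].
    apply/measurable_restrict => //; rewrite -Dt.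
    apply: measurable_funM; last exact: measurable_keep.
    by apply: measurable_funTS; exact: mP.
  rewrite patchE; case: ifPn => _; last by rewrite normr0.
  have /andP[P0 P1] := P01 (t - x).
  by rewrite ger0_norm ?mulr_ge0 ?keep_ge0// mulr_ile1 ?keep_ge0 ?keep_le1.
apply: eq_Rintegral => x /[!inE] /ray_ge0 x0.
rewrite /mix /H patchE indicE !mem_setE !in_itv/= x0/= andbT.
by have [tx|xt] := leP t x; rewrite /= ?mulr1 ?addr0 ?subrK ?mulr0 ?add0r// mulrC.
Qed.

(** As exp turns x + s into a product, [Rintegral_fix] is the linear equation
    phi = psi - psi0 + psi0 phi, and psi0 <= 1 - q < 1. *)
Lemma laplace_fix (z : R) : 0 <= z ->
  let psi := \int[dF]_(x in D) expR (- (z * x)) in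
  let psi0 := \int[dF]_(x in D) (expR (- (z * x)) * k x) in
  \int[L]_(s in D) expR (- (z * s)) = (psi - psi0) / (1 - psi0).
Proof.
move=> z0 psi psi0; set e := fun x : R => expR (- (z * x)).
have me : measurable_fun D e.
  apply: measurableT_comp; first exact: measurable_expR.
  by apply: measurable_funN; exact: measurable_funM.
have e1 x : D x -> `|e x| <= 1.
  move=> /ray_ge0 x0; rewrite ger0_norm ?expR_ge0// -expR0 ler_expR.
  by rewrite oppr_le0 mulr_ge0.
have ie (mu : probability R R) : mu.-integrable D (EFin \o e).
  exact: ray_integrable e1.
have shift x : translate e x = fun s => e x * e s.
  by apply/funext => s; rewrite /translate /e mulrDr opprD expRD.
set phi := \int[L]_(s in D) e s.
have [||x _|x _|_] := @Rintegral_fix R dF dG L L_fix dF_neg L_neg e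
    (fun x => e x * phi).
- exact: me.
- by move=> x _; exact: expR_ge0.
- by rewrite shift; exact: ray_integrableZl.
- by rewrite shift ray_RintegralZl.
rewrite -/phi => phiE.
have ik : dF.-integrable D (EFin \o (fun x => e x * k x)) by exact: keep_integrable.
have E : phi = psi - psi0 + psi0 * phi.
  rewrite {1}phiE.
  transitivity (\int[dF]_(x in D) (e x + (phi - 1) * (e x * k x))).
    by apply: eq_Rintegral => x _; rewrite /mix; ring.
  rewrite (ray_RintegralD (ie dF) (ray_integrableZl _ ik)) ray_RintegralZl//.
  by rewrite -/psi -/psi0; ring.
have psi0_lt1 : psi0 < 1.
  apply: (@le_lt_trans _ _ (1 - q)); last by rewrite ltrBlDr ltrDl.
  have ik1 : dF.-integrable D (EFin \o k).
    apply: (@ray_integrable _ _ _ 1) => [|x _]; first exact: measurable_keep.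
    by rewrite ger0_norm ?keep_ge0 ?keep_le1.
  rewrite -Rintegral_keep; apply: (le_Rintegral _ ik ik1) => // x Dx.
  by rewrite ler_piMl ?keep_ge0// (le_trans _ (e1 x Dx))// ler_norm.
apply: (canRL (mulfK _)); first by rewrite subr_eq0 gt_eqF.
by rewrite mulrBr mulr1 {1}E; ring.
Qed.

End renewal_consequences.

(** * Moments *)

Section moments.
Context (R : realType) (dF dG L : probability R R) (q : R).
Hypothesis L_fix : forall A, measurable A ->
  (L A = ((dF \x dG) \x L) (@restart R @^-1` A))%E.
Hypothesis dF_neg : dF `]-oo, 0[%classic = 0%E.
Hypothesis L_neg : L `]-oo, 0[%classic = 0%E.
Hypothesis q_def : ((dF \x dG) [set p | (p.1 < p.2)%R] = q%:E)%E.
Hypothesis q_gt0 : 0 < q.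
Local Notation k := (keep dG).
Local Notation mix := (mix dG).
Local Notation D := (`[0%R, +oo[%classic : set R).
Notation sq := (fun x : R => x ^+ 2).

(** From |f| <= 1 + f ^ 2. *)
Lemma square_integrable_id (mu : probability R R) (f : R -> R) :
  mu.-integrable D (EFin \o (fun x => f x ^+ 2)) -> measurable_fun D f ->
  mu.-integrable D (EFin \o f).
Proof.
move=> i2 mf.
have i1 : mu.-integrable D (EFin \o (cst 1 : R -> R)).
  by apply: (@ray_integrable _ _ _ 1) => // x _; rewrite normr1.
apply: le_integrable (ray_integrableD i1 i2) => //.
- exact/measurable_EFinP.
- move=> x _ /=; rewrite lee_fin.
  rewrite [leRHS]ger0_norm ?addr_ge0 ?sqr_ge0// -(real_normK (num_real (f x))).
  by move: `|f x| => y; have := sqr_ge0 (y - 1); have := sqr_ge0 y; nra.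
Qed.

Lemma translate_moments (mu : probability R R) (g : R -> R) (x : R) :
  mu `]-oo, 0[%classic = 0%E -> measurable_fun D g ->
  mu.-integrable D (EFin \o (fun s => g s ^+ 2)) ->
  [/\ mu.-integrable D (EFin \o (fun s => x + g s)),
      mu.-integrable D (EFin \o (fun s => (x + g s) ^+ 2)),
      \int[mu]_(s in D) (x + g s) = x + \int[mu]_(s in D) g s &
      \int[mu]_(s in D) ((x + g s) ^+ 2) =
      x ^+ 2 + 2 * x * (\int[mu]_(s in D) g s) + \int[mu]_(s in D) (g s ^+ 2)].
Proof.
move=> mu0 mg ig2; have ig := square_integrable_id ig2 mg.
have ic (c : R) : mu.-integrable D (EFin \o (cst c : R -> R)).
  exact: (@ray_integrable _ _ _ `|c|).
have sqE : (fun s => (x + g s) ^+ 2) =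
    (fun s => cst (x ^+ 2) s + (2 * x * g s + g s ^+ 2)).
  by apply/funext => s /=; ring.
have i' := ray_integrableD (ray_integrableZl (2 * x) ig) ig2.
split.
- exact: ray_integrableD (ic x) ig.
- by rewrite sqE; exact: ray_integrableD.
- by rewrite (ray_RintegralD (ic x) ig) ray_Rintegral_cst.
- rewrite sqE (ray_RintegralD (ic _) i') ray_Rintegral_cst//.
  by rewrite (ray_RintegralD (ray_integrableZl _ ig) ig2) ray_RintegralZl// addrA.
Qed.

(** The upper bound needed for truncated moments: for bounded [h] all integrals
    are finite in advance, and the renewal identity is monotone. *)
Lemma Rintegral_fix_le (h u v : R -> R) (C : R) : measurable_fun setT h ->
  (forall x, D x -> 0 <= h x <= C) ->
  (forall x, D x -> h x <= u x) ->
  (forall x, D x -> \int[L]_(s in D) translate h x s <= v x) ->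
  dF.-integrable D (EFin \o mix u v) ->
  \int[L]_(s in D) h s <= \int[dF]_(x in D) mix u v x.
Proof.
move=> mh hC hu hv iuv.
have h0 x : D x -> 0 <= h x by move=> /hC /andP[].
have hle x : D x -> h x <= C by move=> /hC /andP[].
have it x : D x -> L.-integrable D (EFin \o translate h x).
  move=> Dx; apply: (@ray_integrable _ _ _ C) => [|s Ds].
    by apply: measurable_funTS; apply: measurableT_comp => //; exact: measurable_funD.
  by rewrite ger0_norm /translate ?h0 ?hle//; exact: rayD.
pose H x := \int[L]_(s in D) translate h x s.
have H0C x : D x -> 0 <= H x <= C.
  move=> Dx; apply/andP; split.
    by apply: Rintegral_ge0 => s Ds; rewrite /translate h0//; exact: rayD.
  rewrite -[leRHS](ray_Rintegral_cst C L_neg); apply: le_Rintegral => //.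
  - exact: it.
  - exact: (@ray_integrable _ _ _ `|C|).
  - by move=> s Ds; rewrite /translate hle//; exact: rayD.
have [|x Dx|x Dx|//|mH ->] := @Rintegral_fix R dF dG L L_fix dF_neg L_neg h H.
- exact: measurable_funTS.
- exact: h0.
- exact: it.
have mk := measurable_keep dG (measurable_itv `[0 : R, +oo[).
apply: le_Rintegral => //.
- apply: (@ray_integrable _ _ _ C) => [|x Dx].
    apply: measurable_funD; apply: measurable_funM => //.
      exact: measurable_funB.
    exact: measurable_funTS.
  have /andP[H0 HC] := H0C _ Dx; have := h0 _ Dx; have := hle _ Dx.
  have := keep_ge0 dG x; have := keep_le1 dG x; rewrite /mix.
  move: (k x) (h x) => p y p1 p0 yC y0.
  rewrite ger0_norm ?addr_ge0 ?mulr_ge0 ?subr_ge0//; nra.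
- move=> x Dx; rewrite /mix; apply: lerD; apply: ler_wpM2l.
  + by rewrite subr_ge0 keep_le1.
  + exact: hu.
  + exact: keep_ge0.
  + exact: hv.
Qed.

Hypothesis i2 : dF.-integrable D (EFin \o sq).

Let i1 : dF.-integrable D (EFin \o (id : R -> R)).
Proof. exact: square_integrable_id. Qed.

Let ik : dF.-integrable D (EFin \o k).
Proof.
apply: (@ray_integrable _ _ _ 1) => [|x _]; first exact: measurable_keep.
by rewrite ger0_norm ?keep_ge0 ?keep_le1.
Qed.

Let a := \int[dF]_(x in D) x.
Let b := \int[dF]_(x in D) (x ^+ 2).
Let a0 := \int[dF]_(x in D) (x * k x).

(** The right-hand side of the renewal identity for the first moment, when the
    law [L] has mean [m]. *)
Lemma mix_first m :
  dF.-integrable D (EFin \o mix id (fun x => x + m)) /\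
  \int[dF]_(x in D) mix id (fun x => x + m) x = a + (1 - q) * m.
Proof.
have -> : mix id (fun x => x + m) = (fun x => id x + m * k x).
  by apply/funext => x; rewrite /mix/=; ring.
have ikm := ray_integrableZl m ik; split; first exact: ray_integrableD i1 ikm.
rewrite (ray_RintegralD i1 ikm) ray_RintegralZl// (Rintegral_keep dF_neg q_def).
by rewrite mulrC.
Qed.

(** The same for the second moment, when the law [L] has mean [m] and second
    moment [S]. *)
Lemma mix_second m S :
  dF.-integrable D (EFin \o mix sq (fun x => x ^+ 2 + 2 * x * m + S)) /\
  \int[dF]_(x in D) mix sq (fun x => x ^+ 2 + 2 * x * m + S) x =
  b + 2 * m * a0 + (1 - q) * S.
Proof.
have -> : mix sq (fun x => x ^+ 2 + 2 * x * m + S) =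
    (fun x => sq x + ((2 * m) * (x * k x) + S * k x)).
  by apply/funext => x; rewrite /mix/=; ring.
have ixk := ray_integrableZl (2 * m) (keep_integrable dG i1).
have ikS := ray_integrableZl S ik.
have is' := ray_integrableD ixk ikS.
split; first exact: ray_integrableD i2 is'.
rewrite (ray_RintegralD i2 is') (ray_RintegralD ixk ikS).
rewrite !ray_RintegralZl ?(Rintegral_keep dF_neg q_def)//; last first.
  exact: (keep_integrable dG i1).
by rewrite -/b -/a0; ring.
Qed.

(** Truncation is subadditive in the form min (x + s, n) <= x + min (s, n),
    which turns the renewal identity into m_n <= a + (1 - q) m_n. *)
Let trunc (n : nat) (s : R) := Num.min s n%:R.

Let measurable_trunc n : measurable_fun setT (trunc n).
Proof. exact: measurable_minr. Qed.

Let trunc_bounds n x : D x -> 0 <= trunc n x <= n%:R.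
Proof. by move=> /ray_ge0 x0; rewrite /trunc le_min x0 ler0n ge_min lexx orbT. Qed.

Let trunc_le n x : trunc n x <= x.
Proof. by rewrite /trunc ge_min lexx. Qed.

Let trunc_add n x s : D x -> trunc n (x + s) <= x + trunc n s.
Proof.
move=> /ray_ge0 x0; rewrite /trunc addr_minr le_min ge_min lexx/= ge_min.
by rewrite (_ : n%:R <= x + n%:R) ?orbT// lerDr.
Qed.

Let integrable_trunc_sq n (mu : probability R R) :
  mu.-integrable D (EFin \o (fun s => trunc n s ^+ 2)).
Proof.
apply: (@ray_integrable _ _ _ (n%:R ^+ 2)) => [|s Ds].
  by apply: measurable_funX; exact: measurable_funTS.
have /andP[g0 gn] := trunc_bounds n Ds.
by rewrite ger0_norm ?sqr_ge0// ler_sqr ?nnegrE.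
Qed.

Let integrable_trunc n (mu : probability R R) : mu.-integrable D (EFin \o trunc n).
Proof. by apply: square_integrable_id => //; exact: measurable_funTS. Qed.

Let trunc_first_le n : \int[L]_(s in D) trunc n s <= a / q.
Proof.
set m := \int[L]_(s in D) _.
have [imix mixE] := mix_first m.
suff : m <= a + (1 - q) * m by rewrite ler_pdivlMr//; lra.
rewrite -mixE; apply: (@Rintegral_fix_le _ _ _ n%:R) => //.
- exact: trunc_bounds.
move=> x Dx.
have [iT _ <- _] := translate_moments x L_neg
  (measurable_funTS (measurable_trunc n)) (integrable_trunc_sq n L).
apply: le_Rintegral => //.
- apply: (@ray_integrable _ _ _ n%:R) => [|s Ds].
    by apply: measurable_funTS; apply: measurableT_comp => //; exact: measurable_funD.
  by have /andP[? ?] := trunc_bounds n (rayD Dx Ds); rewrite ger0_norm.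
- by move=> s _; exact: trunc_add.
Qed.

Let trunc_second_le n :
  \int[L]_(s in D) (trunc n s ^+ 2) <= (b + 2 * (a / q) * a0) / q.
Proof.
set S := \int[L]_(s in D) _; set m := \int[L]_(s in D) trunc n s.
have m_le : m <= a / q by exact: trunc_first_le.
have [imix mixE] := mix_second m S.
have a0_ge0 : 0 <= a0.
  by apply: Rintegral_ge0 => x /ray_ge0 x0; rewrite mulr_ge0 ?keep_ge0.
suff : S <= b + 2 * m * a0 + (1 - q) * S.
  by rewrite ler_pdivlMr//; nra.
rewrite -mixE; apply: (@Rintegral_fix_le _ _ _ (n%:R ^+ 2)) => //.
- exact: measurable_funX.
- move=> x Dx; have /andP[gx0 gxn] := trunc_bounds n Dx.
  by rewrite sqr_ge0 ler_sqr ?nnegrE.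
- move=> x Dx; have /andP[gx0 gxn] := trunc_bounds n Dx.
  by rewrite ler_sqr ?nnegrE//; exact: ray_ge0.
move=> x Dx.
have [_ iT _ <-] := translate_moments x L_neg
  (measurable_funTS (measurable_trunc n)) (integrable_trunc_sq n L).
apply: le_Rintegral => //.
- apply: (@ray_integrable _ _ _ (n%:R ^+ 2)) => [|s Ds].
    apply: measurable_funTS; apply: measurable_funX.
    by apply: measurableT_comp => //; exact: measurable_funD.
  have /andP[gx0 gxn] := trunc_bounds n (rayD Dx Ds).
  by rewrite ger0_norm ?sqr_ge0// ler_sqr ?nnegrE.
- move=> s Ds; have /andP[gs0 _] := trunc_bounds n Ds.
  have /andP[gxs0 _] := trunc_bounds n (rayD Dx Ds).
  by rewrite ler_sqr ?nnegrE ?trunc_add// addr_ge0//; exact: ray_ge0.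
Qed.

Let trunc_cvg x : trunc n x @[n --> \oo] --> x.
Proof.
apply: cvg_near_cst.
near=> n; rewrite /trunc min_l//; near: n; exact: nbhs_infty_ger.
Unshelve. all: by end_near. Qed.

Lemma fixed_point_square_integrable : L.-integrable D (EFin \o sq).
Proof.
apply: (@ray_integrable_limit _ L (fun n s => trunc n s ^+ 2) _
  ((b + 2 * (a / q) * a0) / q)) => //.
- by move=> n; apply: measurable_funX; exact: measurable_funTS.
- by move=> n x _; exact: sqr_ge0.
- move=> x Dx m n mn; have /andP[? _] := trunc_bounds m Dx; have /andP[? _] := trunc_bounds n Dx.
  rewrite ler_sqr ?nnegrE// /trunc le_min !ge_min lexx/=.
  by rewrite (_ : m%:R <= n%:R) ?orbT// ler_nat.
- by move=> x _; rewrite !expr2; apply: cvgM; exact: trunc_cvg.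
Qed.

(** The moments being finite, the renewal identity for s and s ^ 2 reads
    m = a + (1 - q) m and S = b + 2 m a0 + (1 - q) S. *)
Lemma fixed_point_moments :
  let m := \int[L]_(s in D) s in let S := \int[L]_(s in D) (s ^+ 2) in
  m = a / q /\ S = (b + 2 * m * a0) / q.
Proof.
move=> m S; have iS := fixed_point_square_integrable.
have T x := translate_moments x L_neg (@measurable_id _ _ D) iS.
have mE : m = a / q.
  have [_ mixE] := mix_first m.
  suff : m = a + (1 - q) * m.
    by move=> E; apply: (canRL (mulfK (lt0r_neq0 q_gt0))); lra.
  have [||x _|x _|_] := @Rintegral_fix R dF dG L L_fix dF_neg L_neg id
    (fun x => x + m).
  - exact: measurable_id.
  - by move=> x /ray_ge0.
  - by have [] := T x.
  - by have [] := T x.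
  by rewrite mixE.
split => //.
have [_ mixE] := mix_second m S.
suff : S = b + 2 * m * a0 + (1 - q) * S.
  by move=> E; apply: (canRL (mulfK (lt0r_neq0 q_gt0))); lra.
have [||x _|x _|_] := @Rintegral_fix R dF dG L L_fix dF_neg L_neg sq
    (fun x => x ^+ 2 + 2 * x * m + S).
- by apply: measurable_funX.
- by move=> x _; exact: sqr_ge0.
- by have [] := T x.
- by have [] := T x.
by rewrite mixE.
Qed.

End moments.

(** * The lossless time as a limit of recursions *)

Section lossless_time.
Context d (Omega : measurableType d) (R : realType) (P : probability Omega R).
Variables tau eta : nat -> {RV P >-> R}.

(** Unrolled from the value 1, the indicator that no loss occurs. *)
Definition survive (z : R * R * R) : R := if z.1.2 <= z.1.1 then z.2 else 0.

Lemma measurable_survive : measurable_fun setT survive.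
Proof.
apply: measurable_fun_ifT => //.
- by apply: measurable_fun_ler; apply: measurableT_comp.
Qed.

Local Notation T := (lossless_time tau eta).
Local Notation Tn := (unrolled tau eta (@restart R) 0).
Local Notation Un := (unrolled tau eta survive 1).

Lemma epsilon1 k w : (epsilon tau eta k w == 1) = (tau k w < eta k w).
Proof.
rewrite /epsilon indicE.
have -> : (w \in [set w | tau k w < eta k w]) = (tau k w < eta k w).
  by apply/idP/idP; rewrite inE.
by case: (tau k w < eta k w); rewrite ?eqxx// eq_sym oner_eq0.
Qed.

Lemma unrolled_no_loss n m w :
  (forall i, (i < n)%N -> eta (m + i)%N w <= tau (m + i)%N w) ->
  Un n m w = 1.
Proof.
elim: n m => [//|n IH] m nl /=; rewrite /survive/=.
rewrite IH => [|i ilen]; last by rewrite addSnnS; exact: nl.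
by have := nl 0%N isT; rewrite addn0 => ->.
Qed.

Lemma unrolled_first_loss n m j w :
  (forall i, (i < j)%N -> eta (m + i)%N w <= tau (m + i)%N w) ->
  tau (m + j)%N w < eta (m + j)%N w -> (j < n)%N ->
  Tn n m w = \sum_(i < j.+1) tau (m + i)%N w /\ Un n m w = 0.
Proof.
elim: j n m => [|j IH] [//|n] m nl lj jn; rewrite /= /restart /survive/=.
  move: lj; rewrite addn0 => lj.
  by rewrite leNgt lj/= big_ord1 addn0.
have -> : eta m w <= tau m w by have := nl 0%N isT; rewrite addn0.
have [|||-> ->] := IH n m.+1.
- by move=> i ij; rewrite addSnnS; exact: nl.
- by rewrite addSnnS.
- by [].
split=> //; rewrite [RHS]big_ord_recl addn0; congr (_ + _).
by apply: eq_bigr => i _; rewrite lift0 addSnnS.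
Qed.

(** The two cases of the definition of [nu], with the index of the first loss
    shifted by one as there. *)
Variant loss_spec (w : Omega) : nat -> Prop :=
| LossAt j of (forall i, (i < j)%N -> eta i w <= tau i w) &
    tau j w < eta j w : loss_spec w j.+1
| LossNever of (forall i, eta i w <= tau i w) : loss_spec w 0.

Lemma nuP w : loss_spec w (nu tau eta w).
Proof.
rewrite /nu; case: pselect => [h|nh].
- case: ex_minnP => j; rewrite epsilon1 => lj jmin.
  apply: LossAt => // i ij; rewrite leNgt -epsilon1.
  by apply: contraTN ij => /jmin; rewrite leqNgt.
- apply: LossNever => i; rewrite leNgt -epsilon1; apply/negP => ei.
  by apply: nh; exists i.
Qed.

(** The truncated recursion is wrong only when no loss has occurred yet, and
    that event is visible on the other recursion. *)
Lemma unrolled_lossless n w : Un n 0 w = 1 \/ Tn n 0 w = T w /\ Un n 0 w = 0.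
Proof.
rewrite /lossless_time; case: nuP => [j nl lj|nl].
- have [jn|nj] := ltnP j n.
    by right; apply: unrolled_first_loss.
  by left; apply: unrolled_no_loss => i /leq_trans/(_ nj); exact: nl.
- by left; apply: unrolled_no_loss => i _; exact: nl.
Qed.

(** The factor makes the convergence hold everywhere, also where no loss ever
    occurs and [T] is 0 by convention; this gives the measurability of [T]. *)
Lemma lossless_limit w :
  Tn n 0 w * (1 - Un n 0 w) @[n --> \oo] --> T w.
Proof.
apply: cvg_near_cst; rewrite /lossless_time; case: nuP => [j nl lj|nl].
- near=> n; have [|||-> ->] := @unrolled_first_loss n 0 j w.
  + by [].
  + by [].
  + by near: n; exact: nbhs_infty_gt.
  by rewrite subr0 mulr1.
- by near=> n; rewrite big_ord0 unrolled_no_loss ?subrr ?mulr0.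
Unshelve. all: by end_near. Qed.

Lemma measurable_lossless_time : measurable_fun setT T.
Proof.
apply: (@measurable_fun_cvg _ _ _ setT (fun n w => Tn n 0 w * (1 - Un n 0 w))).
- move=> n; apply: measurable_funM.
    by apply: measurable_unrolled; exact: measurable_restart.
  apply: measurable_funB => //.
  by apply: measurable_unrolled; exact: measurable_survive.
- by move=> w _; exact: lossless_limit.
Qed.

HB.instance Definition _ :=
  isMeasurableFun.Build _ _ _ _ T measurable_lossless_time.

Lemma lossless_time_neg :
  (forall k, P [set w | tau k w < 0] = 0%E) -> P [set w | T w < 0] = 0%E.
Proof.
move=> tau0.
have mlt (X : {RV P >-> R}) : measurable [set w | X w < 0].
  rewrite (_ : [set _ | _] = X @^-1` `]-oo, 0[); first exact: measurable_funPTI.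
  by apply/seteqP; split=> w /=; rewrite in_itv.
apply/eqP; rewrite -measure_le0.
apply: (@le_trans _ _ (P (\bigcup_k [set w | tau k w < 0]))).
  apply: le_measure; rewrite ?inE; [exact: mlt| |].
    by apply: bigcup_measurable => k _; exact: mlt.
  move=> w /=; apply: contraPP => nT /=; apply/negP; rewrite -leNgt.
  apply: sumr_ge0 => i _; rewrite leNgt; apply/negP => ti.
  by apply: nT; exists (i : nat).
rewrite measure_le0; apply/eqP; apply/negligibleP.
  by apply: bigcup_measurable => k _; exact: mlt.
by apply: negligible_bigcup => k; apply/negligibleP; [exact: mlt|exact: tau0].
Qed.

End lossless_time.

(** * The law of the lossless time is a fixed point *)

(** A bound in total variation is preserved by the product with a fixed
    probability, because it can be integrated over the sections. *)
Lemma product_measure1_le d1 d2 (T1 : measurableType d1) (T2 : measurableType d2)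
    (R : realType) (J : probability T1 R) (mu nu : probability T2 R) (e : R) :
  0 <= e ->
  (forall A, measurable A -> mu A <= nu A + e%:E)%E ->
  forall X, measurable X -> ((J \x mu) X <= (J \x nu) X + e%:E)%E.
Proof.
move=> e0 mn X mX; rewrite /product_measure1.
have -> : (e%:E = \int[J]_x (cst e%:E) x)%E.
  by rewrite integral_cst// [X in (_ * X)%E](_ : _ = 1%E) ?mule1//;
    exact: probability_setT.
rewrite -ge0_integralD//; last exact: measurable_fun_xsection.
apply: ge0_le_integral => //.
- exact: measurable_fun_xsection.
- by apply: emeasurable_funD => //; exact: measurable_fun_xsection.
- by move=> x _ /=; apply: mn; exact: measurable_xsection.
Qed.

Section lossless_law.
Context d (Omega : measurableType d) (R : realType) (P : probability Omega R).
Variables (tau eta : nat -> {RV P >-> R}) (q : R).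
Hypothesis tau_indep : mutually_independent tau.
Hypothesis eta_indep : mutually_independent eta.
Hypothesis tau_eta_indep : independent_sequences tau eta.
Hypothesis tau_id : forall k A, measurable A ->
  P (tau k @^-1` A) = P (tau 0%N @^-1` A).
Hypothesis eta_id : forall k A, measurable A ->
  P (eta k @^-1` A) = P (eta 0%N @^-1` A).
Local Notation dF := (distribution P (tau 0%N)).
Local Notation dG := (distribution P (eta 0%N)).
Hypothesis q_def : ((dF \x dG) [set p | (p.1 < p.2)%R] = q%:E)%E.
Hypothesis q01 : 0 < q < 1.

Local Notation T := (lossless_time tau eta).
Local Notation Tn := (unrolled tau eta (@restart R) 0).
Local Notation Un := (unrolled tau eta (@survive R) 1).

Lemma survive_proba n : P (Un n 0 @^-1` [set 1]) = ((1 - q) ^+ n)%:E.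
Proof.
elim: n => [|n IH].
  rewrite (_ : _ @^-1` _ = setT) ?probability_setT ?expr0//.
  by apply/seteqP; split.
apply: etrans (unrolled_law tau_indep eta_indep tau_eta_indep tau_id eta_id 1
  (@measurable_survive R) n (measurable_set1 (1 : R))) _.
have -> : @survive R @^-1` [set 1] = [set p | p.2 <= p.1] `*` [set 1].
  apply/seteqP; split=> -[p s] /=; rewrite /survive/=.
    by case: ifPn => // _ /esym/eqP; rewrite oner_eq0.
  by case=> -> ->.
pose J : probability (R * R)%type R := (dF \x dG)%E.
apply: etrans (product_measure1E J (distribution P (Un n 0)) (@measurable_no_loss R)
  (measurable_set1 (1 : R))) _.
rewrite exprS EFinM; congr (_ * _)%E; last exact: IH.
exact: (no_loss_proba (J := J)).
Qed.

(** A name of its own for this instance of [unrolled], so that its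
    measurability can be declared and its law formed. *)
Definition truncated_time (n : nat) : Omega -> R := Tn n 0.

HB.instance Definition _ n := isMeasurableFun.Build _ _ _ _ (truncated_time n)
  (measurable_unrolled tau eta 0 (@measurable_restart R) n 0).

Lemma unrolled_law_close n A : measurable A ->
  (distribution P T A <= distribution P (truncated_time n) A + ((1 - q) ^+ n)%:E)%E /\
  (distribution P (truncated_time n) A <= distribution P T A + ((1 - q) ^+ n)%:E)%E.
Proof.
move=> mA; rewrite -survive_proba.
have mT := measurable_lossless_time tau eta.
have mTn := measurable_unrolled tau eta 0 (@measurable_restart R) n 0.
have mUn := measurable_unrolled tau eta 1 (@measurable_survive R) n 0.
have mTA : measurable (T @^-1` A) by rewrite -[X in measurable X]setTI; exact: mT.
have mTnA : measurable (Tn n 0 @^-1` A).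
  by rewrite -[X in measurable X]setTI; exact: mTn.
have mU1 : measurable (Un n 0 @^-1` [set 1]).
  by rewrite -[X in measurable X]setTI; exact: mUn.
split.
- change (P (T @^-1` A) <= P (Tn n 0 @^-1` A) + P (Un n 0 @^-1` [set (1 : R)%R]))%E.
  apply: le_trans (measureU2 P mTnA mU1); apply: le_measure; rewrite ?inE//.
    exact: measurableU.
  by move=> w /= TA; have [?|[-> _]] := unrolled_lossless tau eta n w;
    [right|left].
- change (P (Tn n 0 @^-1` A) <= P (T @^-1` A) + P (Un n 0 @^-1` [set (1 : R)%R]))%E.
  apply: le_trans (measureU2 P mTA mU1); apply: le_measure; rewrite ?inE//.
    exact: measurableU.
  move=> w; rewrite /= /truncated_time.
  by have [?|[-> _]] := unrolled_lossless tau eta n w; [right|left].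
Qed.

(** The law of the truncated time at [n + 1] is the image of the product with
    the law at [n]; each of the two replacements by the law of [T] costs at most
    (1 - q) ^ n. *)
Lemma lossless_law_fix A : measurable A ->
  distribution P T A =
  ((dF \x dG) \x distribution P T)%E (@restart R @^-1` A).
Proof.
move=> mA.
have mrA : measurable (@restart R @^-1` A).
  by rewrite -[X in measurable X]setTI; exact: measurable_restart.
have q1 : `|1 - q| < 1 by have := q01; rewrite ltr_norml => /andP[? ?]; apply/andP; split; lra.
have r0 n : 0 <= (1 - q) ^+ n by apply: exprn_ge0; case/andP: q01 => ? ?; lra.
pose J : probability (R * R)%type R := (dF \x dG)%E.
have stepE n : distribution P (truncated_time n.+1) A =
    (J \x distribution P (truncated_time n))%E (@restart R @^-1` A).
  exact: (unrolled_law tau_indep eta_indep tau_eta_indep tau_id eta_id 0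
    (@measurable_restart R) n mA).
have small (e : R) : 0 < e -> exists n, (1 - q) ^+ n < e.
  move=> e0; have /cvgrPdist_lt/(_ e e0)[n _ /(_ n (leqnn n))] := cvg_expr q1.
  by rewrite sub0r normrN ger0_norm// => ?; exists n.
have step_le n : (1 - q) ^+ n.+1 <= (1 - q) ^+ n.
  by rewrite exprS ler_piMl//; case/andP: q01 => ? _; lra.
have close n B : measurable B -> _ := @unrolled_law_close n B.
apply/eqP; rewrite eq_le; apply/andP; split; apply/lee_addgt0Pr => e e0;
  have [n ne] := small (e / 2) (divr_gt0 e0 (ltr0n _ 2)).
- apply: le_trans (close n.+1 A mA).1 _; rewrite stepE.
  apply: (@le_trans _ _ ((J \x distribution P T) (@restart R @^-1` A) +
    ((1 - q) ^+ n)%:E + ((1 - q) ^+ n.+1)%:E)%E).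
    rewrite leeD2r//; apply: product_measure1_le => // B mB.
    exact: (close n B mB).2.
  rewrite -addeA leeD2l// -EFinD lee_fin.
  by have := step_le n; lra.
- apply: (@le_trans _ _ ((J \x distribution P (truncated_time n)) (@restart R @^-1` A) +
    ((1 - q) ^+ n)%:E)%E).
    apply: product_measure1_le => // B mB.
    exact: (close n B mB).1.
  rewrite -stepE.
  apply: (@le_trans _ _ (distribution P T A + ((1 - q) ^+ n.+1)%:E +
    ((1 - q) ^+ n)%:E)%E).
    by rewrite leeD2r//; exact: (close n.+1 A mA).2.
  rewrite -addeA leeD2l// -EFinD lee_fin.
  by have := step_le n; lra.
Qed.

End lossless_law.

(** * Expectations and distribution functions *)

Section nonnegative_law.
Context d (Omega : measurableType d) (R : realType) (P : probability Omega R).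
Variable X : {RV P >-> R}.
Local Notation mu := (distribution P X).
Hypothesis mu_neg : mu `]-oo, 0[%classic = 0%E.
Local Notation D := (`[0%R, +oo[%classic : set R).
Local Notation sq := (fun x : R => x ^+ 2).

Lemma law_integrable (f : R -> R) : measurable_fun setT f ->
  mu.-integrable D (EFin \o f) <-> P.-integrable setT (EFin \o (f \o X)).
Proof.
move=> mf; have mfe : measurable_fun setT (EFin \o f) by exact/measurable_EFinP.
have E : (\int[mu]_(x in D) `|(EFin \o f) x| =
          \int[P]_w `|(EFin \o (f \o X)) w|)%E.
  rewrite -integral_ray//; last exact: measurableT_comp.
  by rewrite ge0_integral_distribution//; exact: measurableT_comp.
split=> /integrableP[_ fi]; apply/integrableP; split.
- by apply: measurableT_comp => //; exact: measurableT_comp.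
- by rewrite -E.
- exact: measurable_funTS.
- by rewrite E.
Qed.

Lemma law_expectation (f : R -> R) : measurable_fun setT f ->
  mu.-integrable D (EFin \o f) ->
  ('E_P[f \o X])%E = (\int[mu]_(x in D) f x)%:E.
Proof.
move=> mf fi; have /(law_integrable mf) fPi := fi.
have mfe : measurable_fun setT (EFin \o f) by exact/measurable_EFinP.
rewrite unlock -EFin_Rintegral//.
rewrite -[LHS](integral_distribution mfe fPi).
rewrite (@negligible_integral _ _ _ _ setT (`]-oo, (0 : R)[%classic : set R))//.
  by congr integral; rewrite setTD setCitvl.
by apply: integrable_pushforward.
Qed.

Lemma law_moments : mu.-integrable D (EFin \o sq) ->
  let m := \int[mu]_(x in D) x in let S := \int[mu]_(x in D) (x ^+ 2) in
  ('E_P[X])%E = m%:E /\ ('V_P[X])%E = (S - m ^+ 2)%:E.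
Proof.
move=> i2 m S.
have msq : measurable_fun setT sq by exact: measurable_funX.
have i1 : mu.-integrable D (EFin \o id) by exact: square_integrable_id i2 _.
have EX : ('E_P[X])%E = m%:E by exact: (@law_expectation id).
split => //.
have XXE : (X : Omega -> R) * X = sq \o X.
  by apply/funext => w /=; rewrite expr2.
have EX2 : ('E_P[(X : Omega -> R) * X])%E = S%:E.
  by rewrite XXE; exact: law_expectation.
have PX : P.-integrable setT (EFin \o X) by exact/(law_integrable (f := id)).
have PX2 : P.-integrable setT (EFin \o ((X : Omega -> R) * X)).
  by rewrite XXE; exact/law_integrable.
rewrite /variance covarianceE; [|exact/Lfun1_integrable..].
by rewrite EX2 EX -EFinM -EFinB expr2.
Qed.

(** Whatever the value [c] used for centring, even the default 0 for an infinite
    expectation, X ^ 2 <= 2 (X - c) ^ 2 + 2 c ^ 2. *)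
Lemma variance_square_integrable : ('V_P[X] < +oo)%E ->
  mu.-integrable D (EFin \o sq).
Proof.
move=> Vfin; have msq : measurable_fun setT sq by exact: measurable_funX.
apply/law_integrable => //; set c := fine ('E_P[X])%E.
have mc : measurable_fun setT (fun w => (X w - c) ^+ 2).
  by apply: measurable_funX; exact: measurable_funB.
have ic : P.-integrable setT (EFin \o (fun w => (X w - c) ^+ 2)).
  apply/integrableP; split; first exact/measurable_EFinP.
  apply: le_lt_trans Vfin; rewrite /variance !unlock.
  rewrite le_eqVlt; apply/orP; left; apply/eqP; apply: eq_integral => w _ /=.
  by rewrite ger0_norm ?sqr_ge0// expr2 /c unlock.
have ik : P.-integrable setT (EFin \o (cst (c ^+ 2) : Omega -> R)).
  exact: finite_measure_integrable_cst.
have i' := integrableD measurableT (integrableZl measurableT 2 ic)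
  (integrableZl measurableT 2 ik).
apply: le_integrable i' => //.
- by apply/measurable_EFinP; exact: measurableT_comp.
- move=> w _ /=; rewrite lee_fin.
  rewrite !ger0_norm ?sqr_ge0//; last first.
    by apply: addr_ge0; apply: mulr_ge0 => //; exact: sqr_ge0.
  (* The difference of the two sides is the square of X w - 2 c. *)
  by have := sqr_ge0 (X w - 2 * c); nra.
Qed.

End nonnegative_law.

Section distribution_function.
Context d (Omega : measurableType d) (R : realType) (P : probability Omega R).
Variables (X : {RV P >-> R}) (F : R -> R).
Hypothesis F_df : forall t, P [set w | X w < t] = (F t)%:E.
Local Notation mu := (distribution P X).

Lemma df_law t : mu `]-oo, t[%classic = (F t)%:E.
Proof.
by rewrite -F_df; congr (P _); apply/seteqP; split=> w /=; rewrite in_itv.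
Qed.

Lemma df_ge0 t : 0 <= F t.
Proof. by rewrite -lee_fin -df_law. Qed.

Lemma df_nondecreasing : {homo F : x y / x <= y}.
Proof.
move=> x y xy; rewrite -lee_fin -!df_law le_measure ?inE//.
exact: subset_itvl.
Qed.

Lemma df_tail t : fine (mu `[t, +oo[%classic) = 1 - F t.
Proof.
have := probability_setC mu (measurable_itv `]-oo, t[).
rewrite setCitvl => E; transitivity (fine (1 - (F t)%:E)%E) => //.
by congr fine; apply: etrans E _; congr (1 - _)%E; exact: df_law.
Qed.

Lemma df_neg : F t @[t --> 0^'+] --> (0 : R) -> mu `]-oo, 0[%classic = 0%E.
Proof.
move=> F0; rewrite df_law; congr EFin; apply/eqP; rewrite eq_le df_ge0 andbT.
apply: (cvgr_to_ge F0); near=> t; apply: df_nondecreasing.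
by near: t; exact: nbhs_right_ge.
Unshelve. all: by end_near. Qed.

(** For y > x, P(X <= x) <= F y <= P(X <= y), and the outer terms have the same
    limit as y decreases to x. *)
Lemma df_right_limit (K : R -> R) :
  (forall x, F y @[y --> x^'+] --> K x) -> K = keep mu.
Proof.
move=> FK; apply/funext => x; apply: (cvg_unique _ (FK x)) => //.
apply: (@squeeze_cvgr _ _ _ _ (cst (keep mu x)) (keep mu)).
- near=> y; apply/andP; split.
    rewrite -lee_fin keepE -df_law le_measure ?inE//.
    move=> z /=; rewrite !in_itv/= => /le_lt_trans; apply.
    by near: y; exact: nbhs_right_gt.
  rewrite -lee_fin keepE -df_law le_measure ?inE//.
  by move=> z /=; rewrite !in_itv/=; exact: ltW.
- exact: cvg_cst.
- apply: fine_cvg; rewrite keepE; exact: (@cdf_right_continuous _ _ _ P X x).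
Unshelve. all: by end_near. Qed.

End distribution_function.

(** * Losses and ties *)

Section counter_laws.
Context (R : realType) (dF dG : probability R R).
Local Notation D := (`[0%R, +oo[%classic : set R).

(** The sections of the loss event at a fixed discharge time y are the
    half-lines ]-oo, y[, of mass F y. *)
Lemma loss_proba (F : R -> R) : (forall t, dF `]-oo, t[%classic = (F t)%:E) ->
  dG `]-oo, 0[%classic = 0%E ->
  ((dF \x dG) [set p | (p.1 < p.2)%R])%E = (\int[dG]_(t in D) F t)%:E.
Proof.
move=> FE dG0.
have F0 t : 0 <= F t by rewrite -lee_fin -FE.
have F1 t : F t <= 1 by rewrite -lee_fin -FE probability_le1.
have mF : measurable_fun setT F.
  apply: nondecreasing_measurable => // x y xy.
  by rewrite -lee_fin -!FE le_measure ?inE//; exact: subset_itvl.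
rewrite -EFin_Rintegral; last first.
  apply: (@ray_integrable _ _ _ 1) => [|x _]; first exact: measurable_funTS.
  by rewrite ger0_norm.
rewrite -integral_ray//; last exact/measurable_EFinP.
rewrite (@product_measure_unique _ _ _ _ _ dF dG (dF \x^ dG)%E)//.
  apply: eq_integral => y _; rewrite /= -FE; congr (dF _).
  by apply/seteqP; split=> x; rewrite /ysection /= in_itv/= inE.
  by move=> A B mA mB; exact: product_measure2E.
exact: measurable_loss.
Qed.

(** [keep x] and [G x] differ by the mass of the point x, whose integral
    against dF is the probability of a tie. *)
Lemma keep_no_tie (G : R -> R) : (forall t, dG `]-oo, t[%classic = (G t)%:E) ->
  ((dF \x dG) [set p | p.1 = p.2])%E = 0%E ->
  {ae dF, forall x, keep dG x = G x}.
Proof.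
move=> GE tie0.
have mdiag := @measurable_tie R.
have secE x : xsection [set p : R * R | p.1 = p.2] x = [set x].
  by apply/seteqP; split=> y; rewrite /xsection /= inE /= => ->.
have mtie : measurable_fun setT (fun x => dG [set x]).
  have := measurable_fun_xsection dG mdiag.
  by apply: eq_measurable_fun => x _ /=; rewrite secE.
have /(ae_eq_integral_abs _ measurableT mtie) : (\int[dF]_x `|dG [set x]| = 0)%E.
  rewrite -tie0; apply: eq_integral => x _ /=.
  by rewrite secE gee0_abs.
apply: filterS => x /(_ I)/= tie.
apply: EFin_inj; rewrite keepE -GE -[RHS]adde0 -tie -measureU//.
  by congr (dG _); rewrite setUitv1.
by apply/seteqP; split=> // y [] /=; rewrite in_itv/= => /[swap] ->; rewrite ltxx.
Qed.

Lemma Rintegral_ae_keep (K f : R -> R) (A : set R) : measurable A ->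
  measurable_fun setT K -> {ae dF, forall x, keep dG x = K x} ->
  measurable_fun A f ->
  \int[dF]_(x in A) (f x * K x) = \int[dF]_(x in A) (f x * keep dG x).
Proof.
move=> mA mK kK mf; congr fine; apply: ae_eq_integral => //.
- by apply/measurable_EFinP; apply: measurable_funM => //; exact: measurable_funTS.
- apply/measurable_EFinP; apply: measurable_funM => //.
  by apply: measurable_funTS; exact: measurable_keep.
- by apply: filterS kK => x -> _.
Qed.

End counter_laws.
(* With F(t) = P(tau < t) and G(t) = P(eta < t), the conditional probability of
   no loss given tau = x is P(eta <= x) = G(x + 0).  Replacing it by G(x) in the
   integrals against dF is legitimate exactly when P(tau = eta) = 0, and the
   formulas involving G fail otherwise.  Hence they are stated for a function K that
   is G itself when there are no ties, and the right limit of G in general. *)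
Theorem mainTheorem4 (d : measure_display) (Omega : measurableType d)
    (R : realType) (P : probability Omega R)
    (tau eta : nat -> {RV P >-> R}) (F G : R -> R) (q : R)
    (tau_indep : mutually_independent tau)
    (eta_indep : mutually_independent eta)
    (tau_eta_indep : independent_sequences tau eta)
    (tau_df : forall k t, P [set w | tau k w < t] = (F t)%:E)
    (eta_df : forall k t, P [set w | eta k w < t] = (G t)%:E)
    (F0 : F t @[t --> 0^'+] --> (0 : R))
    (G0 : G t @[t --> 0^'+] --> (0 : R))
    (q_def : P [set w | tau 0%N w < eta 0%N w] = q%:E)
    (q01 : 0 < q < 1) :
  let dF : probability R R := distribution P (tau 0%N) in
  let dG : probability R R := distribution P (eta 0%N) in
  let T : Omega -> R := lossless_time tau eta in
  let P_T (t : R) : R := fine (P [set w | t <= T w]) in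
  let phi (z : R) : \bar R := ('E_P[fun w => expR (- (z * T w))])%E in
  let psi (z : R) : R := \int[dF]_(t in `[0, +oo[) expR (- (z * t)) in
  let formulas (K : R -> R) : Prop :=
    let psi0 (z : R) : R :=
      \int[dF]_(t in `[0, +oo[) (expR (- (z * t)) * K t) in
    [/\ forall t : R, 0 <= t ->
          P_T t = 1 - F t + \int[dF]_(x in `[0, t[) (P_T (t - x) * K x),
        forall z : R, 0 <= z ->
          phi z = ((psi z - psi0 z) / (1 - psi0 z))%:E
      & ('V_P[tau 0%N] < +oo)%E ->
          let a := fine ('E_P[tau 0%N])%E in
          let sigma2 := fine ('V_P[tau 0%N])%E in
          let a0 := \int[dF]_(t in `[0, +oo[) (t * K t) in
          ('E_P[T])%E = (a / q)%:E /\
          ('V_P[T])%E =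
            (sigma2 / q + (a ^+ 2 * (q - 1) + 2 * a * a0) / q ^+ 2)%:E] in
  [/\ q = \int[dG]_(t in `[0, +oo[) F t,
      P [set w | tau 0%N w = eta 0%N w] = 0%E -> formulas G
    & forall K : R -> R,
        (forall x, G y @[y --> x^'+] --> K x) -> formulas K].
Proof.
move=> dF dG T P_T phi psi formulas.
have tau_id k A : measurable A -> P (tau k @^-1` A) = P (tau 0%N @^-1` A).
  by move=> mA; apply: law_ext => // t; rewrite !tau_df.
have eta_id k A : measurable A -> P (eta k @^-1` A) = P (eta 0%N @^-1` A).
  by move=> mA; apply: law_ext => // t; rewrite !eta_df.
have FE := df_law (tau_df 0%N); have GE := df_law (eta_df 0%N).
have dF_neg := df_neg (tau_df 0%N) F0; have dG_neg := df_neg (eta_df 0%N) G0.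
have jointE X (mX : measurable X) :
    P ((fun w => (tau 0%N w, eta 0%N w)) @^-1` X) = ((dF \x dG) X)%E.
  exact: (head_law tau_indep eta_indep tau_eta_indep tau_id eta_id 0
    (@measurable_restart R) mX).
have J_loss : ((dF \x dG) [set p : R * R | (p.1 < p.2)%R] = q%:E)%E.
  by rewrite -jointE ?q_def//; exact: measurable_loss.
have [q_gt0 q_lt1] := andP q01.
pose L : probability R R := distribution P T.
have L_fix A : measurable A -> L A = ((dF \x dG) \x L)%E (@restart R @^-1` A).
  exact: (lossless_law_fix tau_indep eta_indep tau_eta_indep tau_id eta_id J_loss q01).
have L_neg : L `]-oo, 0[%classic = 0%E.
  rewrite /L /= /distribution /pushforward.
  rewrite (_ : _ @^-1` _ = [set w | T w < 0]).
    apply: lossless_time_neg => k; rewrite tau_df -FE; exact: dF_neg.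
  by apply/seteqP; split=> w /=; rewrite in_itv.
have P_TE t : P_T t = fine (L `[t, +oo[%classic).
  rewrite /P_T /L /= /distribution /pushforward; congr (fine (P _)).
  by apply/seteqP; split=> w /=; rewrite in_itv/= andbT.
(* [keep dG] satisfies the formulas; K enters through integrals against dF only. *)
have formulas_ae K : measurable_fun setT K ->
    {ae dF, forall x, keep dG x = K x} -> formulas K.
  move=> mK kK; split.
  - move=> t t0; rewrite (Rintegral_ae_keep _ mK kK)//; last first.
      apply: measurable_funTS.
      apply: nondecreasing_measurable => // x y xy; rewrite !P_TE.
      rewrite fine_le ?fin_num_measure// le_measure ?inE//.
      by move=> s /=; rewrite !in_itv/= !andbT; apply: le_trans; lra.
    rewrite P_TE (survival_fix L_fix dF_neg L_neg t0) (df_tail (tau_df 0%N)).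
    by congr (_ + _); apply: eq_Rintegral => x _; rewrite P_TE.
  - move=> z z0.
    have me : measurable_fun setT (fun x : R => expR (- (z * x))).
      apply: measurableT_comp; first exact: measurable_expR.
      by apply: measurable_funN; exact: measurable_funM.
    rewrite (Rintegral_ae_keep _ mK kK)//; last exact: measurable_funTS.
    rewrite -(laplace_fix L_fix dF_neg L_neg J_loss q_gt0 z0).
    apply: (law_expectation (X := T) L_neg me).
    apply: (@ray_integrable _ _ _ 1) => [|x /ray_ge0 x0].
      exact: measurable_funTS.
    by rewrite ger0_norm ?expR_ge0// -expR0 ler_expR oppr_le0 mulr_ge0.
  - move=> Vfin; rewrite (Rintegral_ae_keep _ mK kK)//.
    have i2 := variance_square_integrable dF_neg Vfin.
    have [Etau Vtau] := law_moments dF_neg i2.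
    have iL := fixed_point_square_integrable L_fix dF_neg L_neg J_loss q_gt0 i2.
    have [ET VT] := law_moments (X := T) L_neg iL.
    have [mE SE] := fixed_point_moments L_fix dF_neg L_neg J_loss q_gt0 i2.
    move=> a sigma2 a0; rewrite /a /sigma2 Etau Vtau /=; split.
      by rewrite ET mE.
    (* With b = sigma2 + a ^ 2 this is (b + 2 (a / q) a0) / q - (a / q) ^ 2. *)
    rewrite VT SE mE; congr EFin.
    rewrite -/a0; field; exact: lt0r_neq0.
split.
- by apply: EFin_inj; rewrite -J_loss; exact: loss_proba FE dG_neg.
- move=> tie; apply: formulas_ae.
    by apply: nondecreasing_measurable => //; exact: (df_nondecreasing (eta_df 0%N)).
  apply: keep_no_tie => //; rewrite -jointE//.
  exact: measurable_tie.
- move=> K GK; have -> := df_right_limit (eta_df 0%N) GK.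
  by apply: formulas_ae; [exact: measurable_keep|exact: aeW].
Qed.
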